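(* Let $\bar z\in\Omega$ be an optimal solution of (CLP). Assume that $\beta$-RC is satisfied at $\bar z$ for some $\beta>0$, with index subsets $I_\sharp(t)\subset I_\beta(t)$. Then there exists $u\in L^\infty([0,T];\mathbb{R}^m)$ such that $$c(t)+\sum_{i\in I_\sharp(t)}u_i(t)a_i(t)=0\ \text{ for a.e. } t\in[0,T],$$ $$u_i(t)\ge 0\ \text{ for a.e. } t\in[0,T],\ i\in I.$$
   Context: Setting: $T>0$, and $A:[0,T]\to\mathbb{R}^{m\times n}$, $b:[0,T]\to\mathbb{R}^m$, $c:[0,T]\to\mathbb{R}^n$ have measurable, essentially bounded entries; thus there is $K>0$ with $\|A(t)\|,\|b(t)\|,\|c(t)\|\le K$ for a.e. $t$. Let $I=\{1,\dots,m\}$ and let $a_i(t)^\top$ be the $i$-th row of $A(t)$. Problem (CLP): minimize $F(z)=\int_0^T c(t)^\top z(t)\,dt$ over the feasible set $\Omega=\{z\in L^\infty([0,T];\mathbb{R}^n): A(t)z(t)\le b(t)\text{ a.e. in }[0,T]\}$ (inequalities componentwise). $\bar z\in\Omega$ is an optimal solution if $F(\bar z)\le F(z)$ for all $z\in\Omega$. For $\mathcal I\subset I$, $A^{\mathcal I}(t)$ is the matrix obtained from $A(t)$ by keeping only the rows with index in $\mathcal I$, and $\mathrm{cone}(A^{\mathcal I}(t))$ is the convex cone generated by its rows (all nonnegative linear combinations; $\{0\}$ if $\mathcal I=\emptyset$). The determinant of the $0\times 0$ matrix is $1$. Given $\bar z\in\Omega$ and $\beta>0$, $I_\beta(t)=\{i\in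 I: -\beta\le a_i(t)^\top\bar z(t)-b_i(t)\le 0\}$ ($\beta$-active constraints). $\beta$-RC is satisfied at $\bar z\in\Omega$ if there exist index subsets $I_\sharp(t)\subset I_\beta(t)$ and a constant $\bar K>0$ such that, for a.e. $t\in[0,T]$, $\mathrm{cone}(A^{I_\sharp(t)}(t))=\mathrm{cone}(A^{I_\beta(t)}(t))$ and $\det\big(A^{I_\sharp(t)}(t)A^{I_\sharp(t)}(t)^\top\big)\ge\bar K$. *)

(* Defs.v *)
From HB Require Import structures.
From mathcomp Require Import all_boot all_order all_algebra.
From mathcomp Require Import all_classical all_reals all_analysis.
Set Implicit Arguments.
Unset Strict Implicit.
Unset Printing Implicit Defensive.
Import Order.TTheory GRing.Theory Num.Theory.
Import numFieldNormedType.Exports.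
Local Open Scope classical_set_scope.
Local Open Scope ring_scope.

(* R with the sigma-algebra of Lebesgue-measurable sets: the library's default
   sigma-algebra on R is the Borel one. *)
Definition lebesgueType (R : realType) : measurableType _ :=
  caratheodory_type ((@wlength R idfun)^*)%mu.

(* A function on [0, T] is represented by a function on R whose values outside
   [0, T] are never used. *)
Definition timeItv (R : realType) (T : R) : set (lebesgueType R) := `[0, T].

Definition ae_time (R : realType) (T : R) (P : R -> Prop) : Prop :=
  {ae @completed_lebesgue_measure R, forall t, timeItv T t -> P t}.

(* [\_] extends by 0 outside [0, T], so membership only depends on the
   restriction of M to [0, T]. *)
Definition Linfty (R : realType) (T : R) (p q : nat)
    (M : R -> 'M[R]_(p, q)) : Prop :=
  forall i j, (fun t : lebesgueType R => M t i j) \_ (timeItv T)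
    \in Lfun (@completed_lebesgue_measure R) +oo%E.

Definition cost (R : realType) (T : R) (n : nat) (c z : R -> 'cV[R]_n) : R :=
  \int[@completed_lebesgue_measure R]_(t in timeItv T) ((c t)^T *m z t) 0 0.

Definition feasible (R : realType) (T : R) (m n : nat) (A : R -> 'M[R]_(m, n))
    (b : R -> 'cV[R]_m) (z : R -> 'cV[R]_n) : Prop :=
  Linfty T z /\ ae_time T (fun t => forall i, (A t *m z t) i 0 <= b t i 0).

Definition optimal (R : realType) (T : R) (m n : nat) (A : R -> 'M[R]_(m, n))
    (b : R -> 'cV[R]_m) (c z : R -> 'cV[R]_n) : Prop :=
  feasible T A b z /\
  forall z', feasible T A b z' -> cost T c z <= cost T c z'.

Definition subrows (R : realType) (m n : nat) (I : {set 'I_m})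
    (B : 'M[R]_(m, n)) : 'M[R]_(#|I|, n) :=
  rowsub (fun k : 'I_#|I| => enum_val k) B.

Definition cone (R : realType) (k n : nat) (B : 'M[R]_(k, n)) : set 'rV[R]_n :=
  [set v | exists2 w : 'rV[R]_k, (forall j, 0 <= w 0 j) & v = w *m B].

Definition active (R : realType) (m n : nat) (A : R -> 'M[R]_(m, n))
    (b : R -> 'cV[R]_m) (z : R -> 'cV[R]_n) (beta t : R) : {set 'I_m} :=
  [set i | - beta <= (A t *m z t) i 0 - b t i 0 <= 0]%SET.

(* The beta-regularity condition with the selection Is of index subsets made
   explicit; no measurability of Is is required. *)
Definition beta_RC (R : realType) (T : R) (m n : nat) (A : R -> 'M[R]_(m, n))
    (b : R -> 'cV[R]_m) (z : R -> 'cV[R]_n) (beta : R)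
    (Is : R -> {set 'I_m}) : Prop :=
  exists2 Kbar : R, 0 < Kbar &
    ae_time T (fun t =>
      [/\ Is t \subset active A b z beta t,
          cone (subrows (Is t) (A t)) =
            cone (subrows (active A b z beta t) (A t)) &
          Kbar <= \det (subrows (Is t) (A t) *m (subrows (Is t) (A t))^T)]).

(* Main.v *)
(** Fix an index set J whose rows B(t) generate the cone of the active rows,
    with det (B B^T) >= K. Let u := - (B B^T)^-1 B c be the least-squares
    multiplier, r := - c - B^T u its residual, which satisfies B r = 0, and u^-
    the negative part of u. The direction d := r - B^T (B B^T)^-1 u^- is
    bounded, B d = - u^- <= 0, and c^T d = - |r|^2 - |u^-|^2. Restricted to the
    times where J is such an index set, it can be followed from the optimal
    point, so the integral of c^T d is nonnegative; hence r = 0 and u >= 0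
    almost everywhere there.
    The selection [Is] need not be measurable. However, the coefficient of a
    given row in the decomposition of - c over a simplicial cone does not depend
    on the index set that generates this cone, so the multiplier of index i can
    be defined as the maximum over all the (finitely many) suitable J containing
    i, which is measurable. *)
Require Import Defs.
From HB Require Import structures.
From mathcomp Require Import all_boot all_order all_algebra.
From mathcomp Require Import all_classical all_reals all_analysis.
From mathcomp Require Import measurable_realfun ess_sup_inf lra.
Set Implicit Arguments.
Unset Strict Implicit.
Unset Printing Implicit Defensive.
Import Order.TTheory GRing.Theory Num.Theory.
Import numFieldNormedType.Exports.
Local Open Scope classical_set_scope.
Local Open Scope ring_scope.

(** * Finitely generated cones and coefficients in simplicial cones *)

(** A right inverse [C] of [B] leaves [v *m C] as the only candidate coefficient vector, so
    membership in the cone becomes finitely many inequalities and equations. *)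
Lemma cone_rinvP (R : realType) k n (B : 'M[R]_(k, n)) C (v : 'rV[R]_n) :
  B *m C = 1%:M ->
  cone B v <-> (forall j, 0 <= (v *m C) 0 j) /\ v *m C *m B = v.
Proof.
move=> BC1; split=> [[w w_ge0 ->]|[vC_ge0 vCB]]; last by exists (v *m C).
by rewrite -(mulmxA w) BC1 mulmx1.
Qed.

Lemma row_cone (R : realType) k n (B : 'M[R]_(k, n)) i : cone B (row i B).
Proof.
by exists (delta_mx 0 i); [move=> j; rewrite mxE; case: andP|rewrite rowE].
Qed.

Lemma cone_trans (R : realType) k l n (B : 'M[R]_(k, n)) (B' : 'M[R]_(l, n)) :
  (forall i, cone B (row i B')) -> cone B' `<=` cone B.
Proof.
move=> /(_ _)/cid2-/all_sig2[W W_ge0 WE] _ [w w_ge0 ->].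
exists (\sum_i w 0 i *: W i).
  move=> j; rewrite summxE; apply: sumr_ge0 => i _.
  by rewrite mxE mulr_ge0.
rewrite mulmx_sum_row mulmx_suml; apply: eq_bigr => i _.
by rewrite -scalemxAl -WE.
Qed.

(* The coefficient of [row i B] in a point [v] of the simplicial cone of [B] is
   the largest [x] such that [v - x *: row i B] stays in the cone, hence it only
   depends on the cone and on that row. *)
Lemma cone_coef_le (R : realType) k l n (B : 'M[R]_(k, n)) (B' : 'M[R]_(l, n))
    (w : 'rV[R]_k) (w' : 'rV[R]_l) i i' :
  row_free B -> cone B' `<=` cone B ->
  w *m B = w' *m B' -> (forall j, 0 <= w' 0 j) -> row i B = row i' B' ->
  w' 0 i' <= w 0 i.
Proof.
move=> Bfree sub_cone wB w'_ge0 rowBB'.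
have /sub_cone[v v_ge0 vB] : cone B' (w' *m B' - w' 0 i' *: row i' B').
  exists (w' - w' 0 i' *: delta_mx 0 i').
    move=> j; rewrite !mxE eqxx/=; have [->|_] := eqVneq j i'.
      by rewrite mulr1 subrr.
    by rewrite mulr0 subr0.
  by rewrite mulmxBl -scalemxAl -rowE.
have : (w - w' 0 i' *: delta_mx 0 i) *m B = v *m B.
  by rewrite -vB -wB -rowBB' mulmxBl -scalemxAl -rowE.
move=> /(row_free_inj Bfree)/matrixP/(_ 0 i).
by rewrite !mxE !eqxx mulr1 => vi; rewrite -subr_ge0 vi.
Qed.

Lemma cone_coef_eq (R : realType) k l n (B : 'M[R]_(k, n)) (B' : 'M[R]_(l, n))
    (w : 'rV[R]_k) (w' : 'rV[R]_l) i i' :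
  row_free B -> row_free B' -> cone B = cone B' -> w *m B = w' *m B' ->
  (forall j, 0 <= w 0 j) -> (forall j, 0 <= w' 0 j) ->
  row i B = row i' B' -> w 0 i = w' 0 i'.
Proof.
move=> Bfree B'free coneE wB w_ge0 w'_ge0 rowBB'.
apply/eqP; rewrite eq_le; apply/andP; split.
  by apply: cone_coef_le (esym rowBB') => //; rewrite coneE.
by apply: cone_coef_le rowBB' => //; rewrite coneE.
Qed.

(** * Least-squares multiplier and descent direction at a fixed time *)

Section LeastSquares.
Context (R : realType) (k n : nat).
Implicit Types (K : R) (B : 'M[R]_(k, n)) (c : 'cV[R]_n).

(* The truncation of the determinant at [K] makes this a bounded function of
   bounded [B]; it is the inverse of the Gram matrix when its determinant is at
   least [K]. *)
Definition gram_inv K B : 'M[R]_k :=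
  (Num.max K (\det (B *m B^T)))^-1 *: \adj (B *m B^T).

Definition multiplier K B c : 'cV[R]_k := gram_inv K B *m (B *m (- c)).

Definition residual K B c : 'cV[R]_n := - c - B^T *m multiplier K B c.

Definition neg_part (u : 'cV[R]_k) : 'cV[R]_k :=
  map_mx (fun x => Num.max (- x) 0) u.

Definition descent K B c : 'cV[R]_n :=
  residual K B c - B^T *m (gram_inv K B *m neg_part (multiplier K B c)).

Section Regular.
Context (K : R) (B : 'M[R]_(k, n)) (c : 'cV[R]_n).
Hypotheses (K_gt0 : 0 < K) (detB : K <= \det (B *m B^T)).

Lemma mulmx_gram_inv : B *m B^T *m gram_inv K B = 1%:M.
Proof.
have det_neq0 : \det (B *m B^T) != 0 by rewrite gt_eqF ?(lt_le_trans K_gt0).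
rewrite /gram_inv (max_idPr detB) -scalemxAr mul_mx_adj scale_scalar_mx.
by rewrite mulVf.
Qed.

Lemma gram_rinv : B *m (B^T *m gram_inv K B) = 1%:M.
Proof. by rewrite mulmxA mulmx_gram_inv. Qed.

Lemma gram_row_free : row_free B.
Proof. by apply/row_freeP; exists (B^T *m gram_inv K B); exact: gram_rinv. Qed.

Lemma mulmx_residual : B *m residual K B c = 0.
Proof.
by rewrite mulmxBr /multiplier !mulmxA mulmx_gram_inv mul1mx subrr.
Qed.

Lemma mulmx_descent : B *m descent K B c = - neg_part (multiplier K B c).
Proof.
rewrite mulmxBr mulmx_residual sub0r; congr (- _).
by rewrite !mulmxA mulmx_gram_inv mul1mx.
Qed.

(** Write c = - (r + B^T u). Since r is orthogonal to the rows of [B], r^T d = |r|^2. Since B d = -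
    u^-, the other term is u^T B d = - u^T u^- = |u^-|^2. *)
Lemma descentE : (c^T *m descent K B c) 0 0 =
  - (\sum_j residual K B c j 0 ^+ 2 +
     \sum_j neg_part (multiplier K B c) j 0 ^+ 2).
Proof.
set u := multiplier K B c; set r := residual K B c; set v := neg_part u.
have cE : c^T = - (r^T + u^T *m B).
  rewrite -[B in RHS]trmxK -trmx_mul -linearD -linearN; congr (_^T).
  by rewrite /r /residual subrK opprK.
have rB : r^T *m B^T = 0 by rewrite -trmx_mul mulmx_residual trmx0.
rewrite cE mulNmx mxE; congr (- _).
rewrite mulmxDl -(mulmxA _ B) mulmx_descent.
rewrite {1}/descent mulmxBr -/r (mulmxA r^T) rB mul0mx subr0 !mxE.
congr (_ + _); apply: eq_bigr => j _; rewrite !mxE //.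
(* For a coordinate x of u, what remains is x * (- max(-x, 0)) = max(-x, 0)^2. *)
move: (\sum_j0 _) => x; have [_|_] := leP 0 (- x).
  by rewrite opprK sqrrN expr2.
by rewrite oppr0 mulr0 expr0n.
Qed.

(** Both sums of squares in [descentE] must vanish: a zero residual gives the decomposition of - c,
    a zero negative part gives the signs. *)
Lemma descentP : (c^T *m descent K B c) 0 0 = 0 ->
  - c = B^T *m multiplier K B c /\ forall j, 0 <= multiplier K B c j 0.
Proof.
have sq0 p (v : 'cV[R]_p) : \sum_j v j 0 ^+ 2 = 0 -> v = 0.
  move=> /eqP; rewrite psumr_eq0 => [/allP v0|j _]; last exact: sqr_ge0.
  apply/colP => j; apply/eqP; rewrite mxE -sqrf_eq0.
  exact: (v0 j (mem_index_enum _)).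
have sq_ge0 p (v : 'cV[R]_p) : 0 <= \sum_j v j 0 ^+ 2.
  by apply: sumr_ge0 => j _; exact: sqr_ge0.
rewrite descentE => /eqP; rewrite oppr_eq0 paddr_eq0 //.
move=> /andP[/eqP/sq0/eqP + /eqP/sq0/colP v0]; rewrite subr_eq0 => /eqP cE.
split=> // j; have := v0 j; rewrite !mxE => /eqP.
by rewrite eq_maxr oppr_le0.
Qed.

End Regular.
End LeastSquares.

(** * Stability of measurable essentially bounded functions and matrices *)

Section EssentiallyBounded.
Context d (S : measurableType d) (R : realType).
Context (mu : {measure set S -> \bar R}) (D : set S).
Hypothesis mD : measurable D.
Implicit Types f g : S -> R.

(** Measurability and the bound are kept together, so that one stability lemma per operation
    transports both. No sign is imposed on [M], hence the later passages to [|M|] or a maximum with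
    0. *)
Definition ess_bounded f := measurable_fun D f /\
  exists M, {ae mu, forall t, D t -> `|f t| <= M}.

Definition ess_bounded_mx p q (M : S -> 'M[R]_(p, q)) :=
  forall i j, ess_bounded (fun t => M t i j).

Lemma ess_bounded_cst x : ess_bounded (cst x).
Proof. by split=> //; exists `|x|; apply: aeW. Qed.

Lemma ess_boundedD f g :
  ess_bounded f -> ess_bounded g -> ess_bounded (fun t => f t + g t).
Proof.
move=> [mf [M fM]] [mg [N gN]]; split; first exact: measurable_funD.
exists (M + N); apply: filterS2 fM gN => t fM gN Dt.
by rewrite (le_trans (ler_normD _ _)) // lerD ?fM ?gN.
Qed.

Lemma ess_boundedM f g :
  ess_bounded f -> ess_bounded g -> ess_bounded (fun t => f t * g t).
Proof.
move=> [mf [M fM]] [mg [N gN]]; split; first exact: measurable_funM.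
exists (M * N); apply: filterS2 fM gN => t fM gN Dt.
by rewrite normrM ler_pM ?fM ?gN.
Qed.

Lemma ess_boundedN f : ess_bounded f -> ess_bounded (fun t => - f t).
Proof.
have -> : (fun t => - f t) = (fun t => cst (-1) t * f t).
  by apply/funext => t; rewrite mulN1r.
exact/ess_boundedM/ess_bounded_cst.
Qed.

Lemma ess_bounded_max f g :
  ess_bounded f -> ess_bounded g -> ess_bounded (fun t => Num.max (f t) (g t)).
Proof.
move=> [mf [M fM]] [mg [N gN]]; split; first exact: measurable_maxr.
exists (Num.max M N); apply: filterS2 fM gN => t fM gN Dt.
by rewrite le_max; case: (leP (f t) (g t)) => _; rewrite ?fM ?gN ?orbT.
Qed.

Lemma ess_bounded_big (op : R -> R -> R) x (I : Type) (r : seq I) (P : pred I)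
    (F : I -> S -> R) :
  (forall f g, ess_bounded f -> ess_bounded g ->
    ess_bounded (fun t => op (f t) (g t))) ->
  (forall i, P i -> ess_bounded (F i)) ->
  ess_bounded (fun t => \big[op/x]_(i <- r | P i) F i t).
Proof.
move=> opP FP; elim: r => [|i r IHr].
  by under eq_fun do rewrite big_nil; exact: ess_bounded_cst.
under eq_fun do rewrite big_cons.
by case Pi: (P i) => //; apply: opP => //; exact: FP.
Qed.

Lemma ess_bounded_sum I (r : seq I) (P : pred I) (F : I -> S -> R) :
  (forall i, P i -> ess_bounded (F i)) ->
  ess_bounded (fun t => \sum_(i <- r | P i) F i t).
Proof. by apply: ess_bounded_big; exact: ess_boundedD. Qed.

Lemma ess_bounded_det p (M : S -> 'M[R]_p) :
  ess_bounded_mx M -> ess_bounded (fun t => \det (M t)).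
Proof.
move=> MP; apply: ess_bounded_sum => s _.
apply: ess_boundedM; first exact: ess_bounded_cst.
by apply: ess_bounded_big => [|i _]; [exact: ess_boundedM|exact: MP].
Qed.

(** The truncation keeps the denominator at least [K], so the inverse is at most [K^-1], and x ->
    (max K x)^-1 is continuous on the whole line, hence measurable. *)
Lemma ess_bounded_maxV (K : R) f : 0 < K -> ess_bounded f ->
  ess_bounded (fun t => (Num.max K (f t))^-1).
Proof.
move=> K_gt0 [mf _]; split; last first.
  exists K^-1; apply: aeW => t _.
  have maxK : K <= Num.max K (f t) by rewrite le_max lexx.
  have max_gt0 := lt_le_trans K_gt0 maxK.
  by rewrite ger0_norm ?invr_ge0 ?(ltW max_gt0)// lef_pV2.
apply: (measurableT_comp (f := fun x => (Num.max K x)^-1)) => //.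
apply: continuous_measurable_fun => x; apply: cvgV.
  by rewrite gt_eqF // lt_max K_gt0.
by apply: continuous_max; [exact: cvg_cst|exact: cvg_id].
Qed.

Section Matrices.
Context (p q r : nat).

Lemma ess_bounded_mxD (M N : S -> 'M[R]_(p, q)) :
  ess_bounded_mx M -> ess_bounded_mx N -> ess_bounded_mx (fun t => M t + N t).
Proof.
by move=> MP NP i j; under eq_fun do rewrite mxE; exact: ess_boundedD.
Qed.

Lemma ess_bounded_mxN (M : S -> 'M[R]_(p, q)) :
  ess_bounded_mx M -> ess_bounded_mx (fun t => - M t).
Proof. by move=> MP i j; under eq_fun do rewrite mxE; exact: ess_boundedN. Qed.

Lemma ess_bounded_mxZ f (M : S -> 'M[R]_(p, q)) :
  ess_bounded f -> ess_bounded_mx M -> ess_bounded_mx (fun t => f t *: M t).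
Proof.
by move=> fP MP i j; under eq_fun do rewrite mxE; exact: ess_boundedM.
Qed.

Lemma ess_bounded_mxM (M : S -> 'M[R]_(p, q)) (N : S -> 'M[R]_(q, r)) :
  ess_bounded_mx M -> ess_bounded_mx N -> ess_bounded_mx (fun t => M t *m N t).
Proof.
move=> MP NP i j; under eq_fun do rewrite mxE.
by apply: ess_bounded_sum => k _; exact: ess_boundedM.
Qed.

Lemma ess_bounded_trmx (M : S -> 'M[R]_(p, q)) :
  ess_bounded_mx M -> ess_bounded_mx (fun t => (M t)^T).
Proof. by move=> MP i j; under eq_fun do rewrite mxE; exact: MP. Qed.

Lemma ess_bounded_subrows (I : {set 'I_p}) (M : S -> 'M[R]_(p, q)) :
  ess_bounded_mx M -> ess_bounded_mx (fun t => subrows I (M t)).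
Proof. by move=> MP i j; under eq_fun do rewrite mxE; exact: MP. Qed.

Lemma ess_bounded_row i (M : S -> 'M[R]_(p, q)) :
  ess_bounded_mx M -> ess_bounded_mx (fun t => row i (M t)).
Proof. by move=> MP k j; under eq_fun do rewrite mxE; exact: MP. Qed.

(** The sum of the absolute values of all entries is essentially bounded and dominates each entry,
    which gives one bound and one null set for all of them. *)
Lemma ess_bounded_mx_unif (M : S -> 'M[R]_(p, q)) : ess_bounded_mx M ->
  exists2 N, 0 <= N & {ae mu, forall t, D t -> forall i j, `|M t i j| <= N}.
Proof.
move=> MP.
have [_ [N MN]] : ess_bounded (fun t => \sum_i \sum_j `|M t i j|).
  apply: ess_bounded_sum => i _; apply: ess_bounded_sum => j _.
  have [mM [N MN]] := MP i j; split; first exact: measurableT_comp.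
  by exists N; apply: filterS MN => t; rewrite normr_id.
exists (Num.max 0 N); first by rewrite le_max lexx.
apply: filterS MN => t MN Dt i j; rewrite le_max; apply/orP; right.
apply: le_trans (MN Dt); apply: le_trans (ler_norm _).
rewrite (bigD1 i)//= (bigD1 j)//= -addrA lerDl addr_ge0 ?sumr_ge0// => k _.
exact: sumr_ge0.
Qed.

End Matrices.

Lemma ess_bounded_adj p (M : S -> 'M[R]_p) :
  ess_bounded_mx M -> ess_bounded_mx (fun t => \adj (M t)).
Proof.
move=> MP i j; under eq_fun do rewrite mxE.
apply: ess_boundedM; first exact: ess_bounded_cst.
apply: ess_bounded_det => k l; under eq_fun do rewrite !mxE.
exact: MP.
Qed.

Lemma ess_bounded_bool (b : S -> bool) : measurable_fun D b ->
  ess_bounded (fun t => (b t)%:R).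
Proof.
move=> mb; split.
  have -> : (fun t => (b t)%:R) = (fun t => if b t then 1 else 0 : R).
    by apply/funext => t; case: (b t).
  by apply: measurable_fun_if => //; exact: measurable_cst.
by exists 1; apply: aeW => t _; case: (b t); rewrite ?normr1 ?normr0.
Qed.

Lemma measurable_forall (I : finType) (P : I -> S -> bool) :
  (forall i, measurable_fun D (P i)) ->
  measurable_fun D (fun t => [forall i, P i t]).
Proof.
move=> mP.
have -> : (fun t => [forall i, P i t]) = (fun t => \big[andb/true]_i P i t).
  by apply/funext => t; rewrite big_andE; apply: eq_forallb.
elim: (index_enum I) => [|i r IHr].
  by under eq_fun do rewrite big_nil; exact: measurable_cst.
by under eq_fun do rewrite big_cons; exact: measurable_and.
Qed.

Section LeastSquaresBounded.
Context (k n : nat) (K : R) (B : S -> 'M[R]_(k, n)) (c : S -> 'cV[R]_n).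
Hypotheses (K_gt0 : 0 < K) (BP : ess_bounded_mx B) (cP : ess_bounded_mx c).

Lemma ess_bounded_gram_inv : ess_bounded_mx (fun t => gram_inv K (B t)).
Proof.
have GP : ess_bounded_mx (fun t => B t *m (B t)^T).
  by apply: ess_bounded_mxM => //; exact: ess_bounded_trmx.
apply: ess_bounded_mxZ; last exact: ess_bounded_adj.
by apply: ess_bounded_maxV => //; exact: ess_bounded_det.
Qed.

Lemma ess_bounded_multiplier :
  ess_bounded_mx (fun t => multiplier K (B t) (c t)).
Proof.
apply: ess_bounded_mxM; first exact: ess_bounded_gram_inv.
by apply: ess_bounded_mxM => //; exact: ess_bounded_mxN.
Qed.

Lemma ess_bounded_descent : ess_bounded_mx (fun t => descent K (B t) (c t)).
Proof.
have BT := ess_bounded_trmx BP.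
apply: ess_bounded_mxD; last apply: ess_bounded_mxN.
  apply: ess_bounded_mxD; first exact: ess_bounded_mxN.
  apply: ess_bounded_mxN; apply: ess_bounded_mxM => //.
  exact: ess_bounded_multiplier.
apply: ess_bounded_mxM => //; apply: ess_bounded_mxM.
  exact: ess_bounded_gram_inv.
move=> i j; under eq_fun do rewrite mxE.
apply: ess_bounded_max; last exact: ess_bounded_cst.
by apply: ess_boundedN; exact: ess_bounded_multiplier.
Qed.

End LeastSquaresBounded.

Section Integration.
Hypothesis D_fin : (mu D < +oo)%E.

Lemma ess_bounded_integrable f : ess_bounded f -> mu.-integrable D (EFin \o f).
Proof.
move=> [mf [M fM]]; have mEf : measurable_fun D (EFin \o f).
  exact/measurable_EFinP.
apply/integrableP; split=> //.
apply: (@le_lt_trans _ _ (\int[mu]_(t in D) (cst `|M|%:E) t)%E).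
  apply: ae_ge0_le_integral => //.
  - exact: measurableT_comp.
  - by move=> t _; rewrite /= lee_fin.
  apply: filterS fM => t fM Dt.
  by rewrite /= lee_fin (le_trans (fM Dt)) // ler_norm.
by rewrite integral_cst// lte_mul_pinfty.
Qed.

(** As f <= 0, the integral of |f| is minus that of f, hence both nonnegative and nonpositive. *)
Lemma ae_eq0_integral f : ess_bounded f -> (forall t, D t -> f t <= 0) ->
  0 <= \int[mu]_(t in D) f t -> {ae mu, forall t, D t -> f t = 0}.
Proof.
move=> fP f_le0 int_ge0; have intf := ess_bounded_integrable fP.
have mf : measurable_fun D (EFin \o f) by case/integrableP: intf.
suff : (\int[mu]_(t in D) `|(EFin \o f) t| = 0)%E.
  move=> /(ae_eq_integral_abs mu mD mf); apply: filterS => t ft Dt.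
  by have [] := ft Dt.
have absE : (\int[mu]_(t in D) `|(EFin \o f) t| =
    (- \int[mu]_(t in D) f t)%:E)%E.
  rewrite EFinN fineK; last exact: integrable_fin_num.
  rewrite -integralN; last exact: integrable_add_def.
  by apply: eq_integral => t /[!inE] Dt; rewrite /= ler0_norm ?f_le0.
apply/eqP; rewrite eq_le integral_ge0 ?andbT.
  by rewrite absE lee_fin oppr_le0.
by move=> t _; exact: abse_ge0.
Qed.

End Integration.

End EssentiallyBounded.

(** * Measurable multipliers from a descent condition *)

Section Multipliers.
Context d (S : measurableType d) (R : realType).
Context (mu : {measure set S -> \bar R}) (D : set S).
Hypotheses (mD : measurable D) (D_fin : (mu D < +oo)%E).
Context (m n : nat) (A : S -> 'M[R]_(m, n)) (c : S -> 'cV[R]_n).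
Hypotheses (AP : ess_bounded_mx mu D A) (cP : ess_bounded_mx mu D c).
Context (act : S -> {set 'I_m}).
Hypothesis mact : forall i, measurable_fun D (fun t => i \in act t).
(** This is the form in which optimality enters the section: a bounded direction that increases no
    active constraint has nonnegative cost. *)
Hypothesis act_descent : forall v : S -> 'cV[R]_n, ess_bounded_mx mu D v ->
  (forall t, D t -> forall i, i \in act t -> (A t *m v t) i 0 <= 0) ->
  0 <= \int[mu]_(t in D) ((c t)^T *m v t) 0 0.
Context (K : R).
Hypothesis K_gt0 : 0 < K.

Section FixedIndexSet.
Context (J : {set 'I_m}).

Let B t := subrows J (A t).
Let C t := (B t)^T *m gram_inv K (B t).

(** The regularity condition for the fixed set [J] as a boolean. Equality of cones is tested through
    the right inverse [C] of [B], row by row, so that the condition is visibly measurable in t. *)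
Definition regular t :=
  [&& K <= \det (B t *m (B t)^T), [forall i, (i \in J) ==> (i \in act t)] &
      [forall i, (i \in act t) ==>
        [forall j, 0 <= (row i (A t) *m C t) 0 j] &&
        [forall j, (row i (A t) *m C t *m B t) 0 j == A t i j]]].

Lemma regularP t : regular t <->
  [/\ J \subset act t, cone (B t) = cone (subrows (act t) (A t)) &
      K <= \det (B t *m (B t)^T)].
Proof.
have row_sub (I : {set 'I_m}) k :
    row k (subrows I (A t)) = row (enum_val k) (A t).
  by apply/rowP => j; rewrite !mxE.
have row_act i (I : {set 'I_m}) :
    i \in I -> cone (subrows I (A t)) (row i (A t)).
  by move=> iI; rewrite -(enum_rankK_in iI iI) -row_sub; exact: row_cone.
split=> [/and3P[detB /forallP JI /forallP actB]|
  [/fintype.subsetP JI coneE detB]].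
  split=> //.
    by apply/fintype.subsetP => i iJ; have /implyP := JI i; apply.
  apply/seteqP; split; apply: cone_trans => i; rewrite row_sub.
    by apply: row_act; have /implyP := JI (enum_val i); apply; exact: enum_valP.
  have /implyP/(_ (enum_valP i))/andP[/forallP ge0 /forallP eqA] :=
    actB (enum_val i).
  apply/(cone_rinvP _ (gram_rinv K_gt0 detB)); split=> //.
  by apply/rowP => j; rewrite (eqP (eqA j)) mxE.
apply/and3P; split=> //; first by apply/forallP => i; apply/implyP => /JI.
apply/forallP => i; apply/implyP => /row_act.
rewrite -coneE => /(cone_rinvP _ (gram_rinv K_gt0 detB))[ge0 eqA].
apply/andP; split; apply/forallP => j; first exact: ge0.
by rewrite /C eqA mxE.
Qed.

Let BP : ess_bounded_mx mu D B.
Proof. exact: ess_bounded_subrows. Qed.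

Lemma measurable_regular : measurable_fun D regular.
Proof.
have CP : ess_bounded_mx mu D C.
  apply: ess_bounded_mxM => //; first exact: ess_bounded_trmx.
  exact: ess_bounded_gram_inv.
have rowCP i : ess_bounded_mx mu D (fun t => row i (A t) *m C t).
  by apply: ess_bounded_mxM => //; exact: ess_bounded_row.
have imply_and (f g : S -> bool) : measurable_fun D f -> measurable_fun D g ->
    measurable_fun D (fun t => f t ==> g t).
  move=> mf mg; under eq_fun do rewrite implybE.
  by apply: measurable_or => //; exact: measurable_neg.
apply: measurable_and.
  apply: measurable_fun_ler; first exact: measurable_cst.
  have GP := ess_bounded_mxM BP (ess_bounded_trmx BP).
  exact: (ess_bounded_det GP).1.
apply: measurable_and; apply: measurable_forall => i; apply: imply_and => //.
apply: measurable_and; apply: measurable_forall => j.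
  by apply: measurable_fun_ler; [exact: measurable_cst|exact: (rowCP i 0 j).1].
apply: measurable_fun_eqr; last exact: (AP i j).1.
exact: (ess_bounded_mxM (rowCP i) BP 0 j).1.
Qed.

Lemma ae_regular_multiplier :
  {ae mu, forall t, D t -> regular t ->
    - c t = (B t)^T *m multiplier K (B t) (c t) /\
    forall k, 0 <= multiplier K (B t) (c t) k 0}.
Proof.
(* The indicator switches the direction off at the times where [J] is not regular; there neither
   sign information on [B d] nor the formula for c^T d is available. *)
pose v t := (regular t)%:R *: descent K (B t) (c t).
have vP : ess_bounded_mx mu D v.
  apply: ess_bounded_mxZ => //; last exact: ess_bounded_descent.
  exact/ess_bounded_bool/measurable_regular.
have cvE t : ((c t)^T *m v t) 0 0 =
    (regular t)%:R * ((c t)^T *m descent K (B t) (c t)) 0 0.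
  by rewrite -scalemxAr mxE.
have Bdesc_le0 t : regular t ->
    forall k, (B t *m descent K (B t) (c t)) k 0 <= 0.
  move=> /and3P[detB _ _] k.
  by rewrite (mulmx_descent _ K_gt0 detB) !mxE oppr_le0 le_max lexx orbT.
have /(ae_eq0_integral mD D_fin) ae0 :
    ess_bounded mu D (fun t => ((c t)^T *m v t) 0 0).
  exact: (ess_bounded_mxM (ess_bounded_trmx cP) vP).
apply: filterS (ae0 _ _) => [t cv0 Dt rt|t Dt|].
- have /and3P[detB _ _] := rt; apply: descentP => //.
  by have := cv0 Dt; rewrite cvE rt mul1r.
- rewrite cvE; have [/and3P[detB _ _]|_] := boolP (regular t).
    rewrite mul1r (descentE _ K_gt0 detB) oppr_le0 addr_ge0 ?sumr_ge0 // => j _;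
    exact: sqr_ge0.
  by rewrite mul0r.
apply: act_descent => // t Dt i it.
rewrite -scalemxAr mxE; have [rt|_] := boolP (regular t); last by rewrite mul0r.
have /and3P[detB _ /forallP/(_ i)/implyP/(_ it)] := rt.
move=> /andP[/forallP ge0 /forallP eqA].
(* An active row is the combination of the rows of [B] with nonnegative coefficients
   [row i (A t) *m C t], so its product with d is a nonnegative combination of the entries of B d <=
   0. *)
have -> : (A t *m descent K (B t) (c t)) i 0 =
    (row i (A t) *m C t *m (B t *m descent K (B t) (c t))) 0 0.
  rewrite mulmxA [in RHS]mxE [in LHS]mxE; apply: eq_bigr => j _.
  by rewrite (eqP (eqA j)).
rewrite mul1r mxE; apply: sumr_le0 => k _.
by rewrite mulr_ge0_le0 //; exact: Bdesc_le0.
Qed.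

End FixedIndexSet.

Lemma sum_enum_val (J : {set 'I_m}) (F : 'I_#|J| -> R) k :
  \sum_(k' < #|J| | enum_val k' == enum_val k) F k' = F k.
Proof.
by under eq_bigl => k' do rewrite (inj_eq enum_val_inj); rewrite big_pred1_eq.
Qed.

Lemma exists_multiplier (Is : S -> {set 'I_m}) :
  {ae mu, forall t, D t -> regular (Is t) t} ->
  exists u : S -> 'cV[R]_m,
    [/\ ess_bounded_mx mu D u,
        {ae mu, forall t, D t ->
          c t + \sum_(i in Is t) u t i 0 *: (row i (A t))^T = 0} &
        forall t i, 0 <= u t i 0].
Proof.
move=> IsP.
pose w J t := multiplier K (subrows J (A t)) (c t).
(* The sum picks the entry of [w J t] attached to row [i], without a dependent index: it has one
   term when [i] lies in [J]. The factor in front makes it 0 at times where [J] is not regular. *)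
pose coef i (J : {set 'I_m}) t :=
  (regular J t)%:R * \sum_(k < #|J| | enum_val k == i) w J t k 0.
(* Starting the maximum at 0 makes u nonnegative at every time. *)
exists (fun t => \col_i \big[Num.max/0]_(J : {set 'I_m} | i \in J) coef i J t).
split.
- move=> i j; under eq_fun do rewrite mxE.
  apply: ess_bounded_big => [f g|J _]; first exact: ess_bounded_max.
  apply: ess_boundedM => //.
    exact/ess_bounded_bool/measurable_regular.
  apply: ess_bounded_sum => // k _.
  by apply: ess_bounded_multiplier => //; exact: ess_bounded_subrows.
- have ae_mult : {ae mu, forall t, forall J : {set 'I_m}, D t -> regular J t ->
      - c t = (subrows J (A t))^T *m w J t /\ forall k, 0 <= w J t k 0}.
    (* There are finitely many [J], so their exceptional null sets can be united. *)
    by apply: filter_forall => J; exact: ae_regular_multiplier.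
  apply: filterS2 IsP ae_mult => t + mult Dt => /(_ Dt) regI.
  set I := Is t in regI *.
  have [cE w_ge0] := mult I Dt regI.
  (* The cones of [J] and [I] both equal the active cone and both decompose - c, so a row they share
     has the same coefficient in each. *)
  have coefE k (J : {set 'I_m}) : regular J t -> enum_val k \in J ->
      coef (enum_val k) J t = w I t k 0.
    move=> regJ kJ; rewrite /coef regJ mul1r.
    rewrite -(enum_rankK_in kJ kJ) sum_enum_val; set k' := enum_rank_in _ _.
    have [cE' w_ge0'] := mult J Dt regJ.
    have [_ coneJ detJ] := (regularP J t).1 regJ.
    have [_ coneI detI] := (regularP I t).1 regI.
    have := @cone_coef_eq _ _ _ _ (subrows J (A t)) (subrows I (A t))
      (w J t)^T (w I t)^T k' k.
    rewrite !mxE; apply.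
    + exact: gram_row_free detJ.
    + exact: gram_row_free detI.
    + by rewrite coneJ.
    + by apply: trmx_inj; rewrite !trmx_mul !trmxK -cE'.
    + by move=> j; rewrite mxE.
    + by move=> j; rewrite mxE.
    + by apply/matrixP => z j; rewrite !mxE enum_rankK_in.
  (* Regular sets all contribute the same value, which is nonnegative; the others contribute 0, and
     [I] itself attains the maximum. *)
  have uE k : \big[Num.max/0]_(J : {set 'I_m} | enum_val k \in J)
      coef (enum_val k) J t = w I t k 0.
    apply/eqP; rewrite eq_le; apply/andP; split.
      apply: bigmax_le => // J kJ.
      have [regJ|/negbTE regJ] := boolP (regular J t); first by rewrite coefE.
      by rewrite /coef regJ mul0r.
    by rewrite -(coefE k I) ?enum_valP// le_bigmax_cond// enum_valP.
  rewrite -[c t]opprK cE; apply/eqP; rewrite addrC subr_eq0; apply/eqP.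
  under eq_bigr do rewrite mxE.
  rewrite big_enum_val/=; under eq_bigr do rewrite uE.
  apply: trmx_inj; rewrite trmx_mul trmxK mulmx_sum_row linear_sum.
  apply: eq_bigr => k _; rewrite linearZ/= trmxK; congr (_ *: _).
    by rewrite [RHS]mxE.
  by apply/rowP => j; rewrite !mxE.
by move=> t i; rewrite mxE; exact: bigmax_ge_id.
Qed.

End Multipliers.

(** * Essential boundedness on the time interval *)

Lemma Lfunoo_restrictP d (S : measurableType d) (R : realType)
    (mu : {measure set S -> \bar R}) (D : set S) (f : S -> R) :
  measurable D ->
  (f \_ D \in Lfun mu +oo%E) <-> ess_bounded mu D f.
Proof.
move=> mD; have absE : abse \o (EFin \o f \_ D) = EFin \o (Num.norm \o f \_ D).
  by apply/funext => t.
have normD t : D t -> `|(f \_ D) t| = `|f t|.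
  by move=> Dt; rewrite /patch mem_set.
split=> [/andP[/[!inE]/= mf ff]|[mf [M fM]]].
  split; first exact/(measurable_restrictT f mD).
  move: ff; rewrite /finite_norm unlock /Lnorm absE.
  case: ifPn => [_ /ess_supr_bounded[M fM]|mu0 _].
    by exists M; apply: filterS fM => t fM Dt; rewrite -normD.
  (* In this branch the whole space has measure zero, so [setT] serves as the exceptional set. *)
  exists 0, setT; split=> //; apply/eqP.
  by move: mu0; rewrite lt0e measure_ge0 andbT negbK.
apply/andP; split; rewrite inE/=; first exact/(measurable_restrictT f mD).
rewrite /finite_norm unlock /Lnorm absE; case: ifPn => // _.
(* The maximum with 0 covers the points outside [D], where the extension vanishes. *)
apply: (@le_lt_trans _ _ (Num.max 0 M)%:E); last exact: ltry.
apply/ess_supP; apply: filterS fM => t fM.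
rewrite /= lee_fin le_max /patch; case: ifPn => [/set_mem Dt|_].
  by rewrite fM ?orbT.
by rewrite normr0 lexx.
Qed.

Lemma measurable_timeItv (R : realType) (T : R) : measurable (timeItv T).
Proof.
apply: sub_caratheodory.
exact: (@measurable_itv R `[0, T]).
Qed.

Lemma timeItv_fin (R : realType) (T : R) :
  (@completed_lebesgue_measure R (timeItv T) < +oo)%E.
Proof.
have -> : @completed_lebesgue_measure R (timeItv T) =
    lebesgue_measure (`[0, T]%classic : set R) by [].
rewrite lebesgue_measure_itv; case: ifP => // _.
by rewrite -EFinB ltry.
Qed.

Lemma LinftyP (R : realType) (T : R) p q (M : R -> 'M[R]_(p, q)) :
  Linfty T M <->
  ess_bounded_mx (@completed_lebesgue_measure R) (timeItv T)
    (M : lebesgueType R -> _).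
Proof.
split=> MP i j; first exact/(Lfunoo_restrictP _ _ (@measurable_timeItv R T))/MP.
exact/Lfunoo_restrictP/MP/measurable_timeItv.
Qed.

(** * Admissible directions at an optimal point *)

Section OptimalDescent.
Context (R : realType) (T : R) (m n : nat).
Context (A : R -> 'M[R]_(m, n)) (b : R -> 'cV[R]_m) (c z : R -> 'cV[R]_n).
Context (beta : R).
Hypotheses (AP : Linfty T A) (cP : Linfty T c).
Hypotheses (beta_gt0 : 0 < beta) (z_opt : optimal T A b c z).

(** A short enough step along v stays feasible: active constraints do not increase, and the others
    have slack more than [beta]. Comparing costs at the two points and dividing by the step length
    gives the sign. *)
Lemma optimal_descent v : Linfty T v ->
  (forall t, timeItv T t -> forall i, i \in active A b z beta t ->
    (A t *m v t) i 0 <= 0) ->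
  0 <= cost T c v.
Proof.
have mD := @measurable_timeItv R T.
move=> vP v_le0; have [[zP +] z_min] := z_opt; rewrite /ae_time => z_feas.
move: vP zP cP AP => /LinftyP vP /LinftyP zP /LinftyP cP' /LinftyP AP'.
have [N N_ge0 AvN] := ess_bounded_mx_unif (ess_bounded_mxM AP' vP).
(* With |A v| <= N almost everywhere, a step of this length changes each constraint by at most
   [beta]; adding 1 keeps the denominator positive when N = 0. *)
pose eps := beta / (N + 1).
have N1_gt0 : 0 < N + 1 by rewrite ltr_wpDl.
have eps_gt0 : 0 < eps by rewrite divr_gt0.
have evP : ess_bounded_mx (@completed_lebesgue_measure R) (timeItv T)
    (fun t : lebesgueType R => eps *: v t).
  by apply: ess_bounded_mxZ => //; exact: ess_bounded_cst.
have /z_min : feasible T A b (fun t => z t + eps *: v t).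
  split; first exact/LinftyP/ess_bounded_mxD.
  rewrite /ae_time; apply: filterS2 z_feas AvN => t z_feas AvN Dt i.
  rewrite mulmxDr -scalemxAr !mxE.
  have [it|] := boolP (i \in active A b z beta t).
    have := v_le0 t Dt i it; have := z_feas Dt i; rewrite !mxE => Az Av.
    by have := mulr_ge0_le0 (ltW eps_gt0) Av; lra.
  (* At a feasible point, a constraint can only fail to be active through A z - b < - beta. *)
  rewrite inE [X in _ && X]subr_le0 (z_feas Dt i) andbT -ltNge.
  have := le_trans (ler_norm _) (AvN Dt i 0); rewrite !mxE => Av Az.
  have : eps * \sum_j A t i j * v t j 0 <= beta.
    apply: (@le_trans _ _ (eps * (N + 1))); last by rewrite divfK ?gt_eqF.
    by rewrite ler_pM2l //; lra.
  by lra.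
have int_cost w : ess_bounded_mx (@completed_lebesgue_measure R) (timeItv T)
    (w : lebesgueType R -> 'cV[R]_n) ->
    (@completed_lebesgue_measure R).-integrable (timeItv T)
      (EFin \o (fun t => ((c t)^T *m w t) 0 0)).
  move=> wP; have cwP := ess_bounded_mxM (ess_bounded_trmx cP') wP.
  exact: (ess_bounded_integrable mD (timeItv_fin T) (cwP 0 0)).
have -> : cost T c (fun t => z t + eps *: v t) = cost T c z + eps * cost T c v.
  rewrite /cost -RintegralZl//; last exact: int_cost.
  rewrite -RintegralD//; last 2 first.
  - exact: int_cost.
  - have := int_cost _ evP; congr (_.-integrable _ _); apply/funext => t.
    by rewrite /= -scalemxAr mxE.
  apply: eq_Rintegral => t _.
  by rewrite mulmxDr -scalemxAr !mxE.
by rewrite lerDl pmulr_rge0.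
Qed.

End OptimalDescent.

Lemma measurable_active (R : realType) (T : R) m n
    (A : R -> 'M[R]_(m, n)) (b : R -> 'cV[R]_m) (z : R -> 'cV[R]_n) beta i :
  Linfty T A -> Linfty T b -> Linfty T z ->
  measurable_fun (timeItv T)
    (fun t : lebesgueType R => i \in active A b z beta t).
Proof.
move=> /LinftyP AP /LinftyP bP /LinftyP zP.
have [mAz _] := ess_boundedD (ess_bounded_mxM AP zP i 0)
  (ess_boundedN (bP i 0)).
under eq_fun do rewrite inE.
by apply: measurable_and; apply: measurable_fun_ler.
Qed.

Theorem theorem3p1 (R : realType) (T : R) (m n : nat)
    (A : R -> 'M[R]_(m, n)) (b : R -> 'cV[R]_m) (c : R -> 'cV[R]_n)
    (zbar : R -> 'cV[R]_n) (beta : R) (Is : R -> {set 'I_m}) :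
  0 < T ->
  Linfty T A -> Linfty T b -> Linfty T c ->
  optimal T A b c zbar ->
  0 < beta ->
  beta_RC T A b zbar beta Is ->
  exists u : R -> 'cV[R]_m,
    [/\ Linfty T u,
        ae_time T (fun t =>
          c t + \sum_(i in Is t) u t i 0 *: (row i (A t))^T = 0) &
        ae_time T (fun t => forall i, 0 <= u t i 0)].
Proof.
move=> _ AP bP cP z_opt beta_gt0 [K K_gt0 IsP].
have [[zP _] _] := z_opt.
have /LinftyP AP' := AP; have /LinftyP cP' := cP.
have descent_ge0 (v : lebesgueType R -> 'cV[R]_n) :
    ess_bounded_mx (@completed_lebesgue_measure R) (timeItv T) v ->
    (forall t, timeItv T t -> forall i, i \in active A b zbar beta t ->
      (A t *m v t) i 0 <= 0) -> 0 <= cost T c v.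
  move=> /LinftyP vP v_le0.
  exact: (optimal_descent AP cP beta_gt0 z_opt vP v_le0).
have [|u [uP u_sum u_ge0]] := @exists_multiplier _ _ _ _ _
  (@measurable_timeItv R T) (@timeItv_fin R T) _ _ _ _ AP' cP' _
  (fun i => measurable_active beta i AP bP zP) descent_ge0 K K_gt0 Is.
  (* With the [beta]-active set as [act], the regularity condition says that [Is t] is regular at
     almost every time t. *)
  rewrite /ae_time in IsP; apply: filterS IsP => t + Dt.
  move=> /(_ Dt)[IsA coneE detE].
  exact/(regularP _ _ K_gt0).
exists u; split=> //; first exact/LinftyP.
by apply: aeW => t _.
Qed.
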